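(* Let $p\ge 2$ be an integer and let $D$ be an infinite $p$-digit table with domain $\mathbb{Z}_p$ that has the block property. Then there is a unique (closed) $p$-fibred function $F_D$ in canonical form whose $F_D$-digit table is equal to $D$. In particular, $F_D$ is a $p$-adic system.
   Context: $p\ge2$ is an integer, not necessarily prime. $\mathbb{Z}_p=\varprojlim \mathbb{Z}/p^k\mathbb{Z}$; every $a\in\mathbb{Z}_p$ is uniquely $a=\sum_{i\ge0}a_ip^i$ with $a_i\in\{0,\dots,p-1\}$, and $a\,\%\,p^k:=\sum_{i<k}a_ip^i\in\{0,\dots,p^k-1\}$. Infinite $p$-digit table with domain $A\subseteq\mathbb{Z}_p$: a family $D=(D[n])_{n\in A}$ of infinite sequences $D[n]=(D[n][0],D[n][1],\dots)$ with entries in $\{0,\dots,p-1\}$ such that $D[n][0]=n\,\%\,p$ for all $n\in A$. It has the block property if for all integers $k\ge0$ and all $m,n\in A$: $m\equiv n \pmod{p^k}$ if and only if the first $k$ entries of $D[m]$ and $D[n]$ coincide. $p$-fibred function with domain $A\subseteq\mathbb{Z}_p$: a $p$-tuple $F=(F[0],\dots,F[p-1])$ of functions $F[r]:A\to\mathbb{Z}_p$. It is also regarded as a function $F:A\to\mathbb{Z}_p$ by $F(n)=\dfrac{F[n\%p](n)-(F[n\%p](n)\,\%\,p)}{p}$. $F$ is closed if $F(A)\subseteq A$. For closed $F$ the $F$-digit table is the family, indexed by $n\in A$, of the sequences $(F^k(n)\,\%\,p)_{k\ge0}$; it is an infinite $p$-digit table with domain $A$. A $p$-adic system is a $p$-fibred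 function with domain $\mathbb{Z}_p$ whose $F$-digit table has the block property. $F$ is in canonical form if for all $r\in\{0,\dots,p-1\}$ and all $n$ in its domain: $F[r](n)\in p\mathbb{Z}_p$ if $n\equiv r\pmod p$, and $F[r](n)=0$ if $n\not\equiv r\pmod p$. *)

(* Defs.v *)
From HB Require Import structures.
From mathcomp Require Import all_boot all_order all_algebra.
From mathcomp Require Import boolp classical_sets.

Set Implicit Arguments.
Unset Strict Implicit.
Unset Printing Implicit Defensive.

Import Order.TTheory GRing.Theory Num.Theory.
Local Open Scope ring_scope.

(* The inverse limit of the rings Z/p^k.  The class modulo p^k is represented
   by its canonical remainder a k in {0, ..., p^k - 1} (an int, so that no ring
   structure on the trivial quotient Z/p^0 is needed).  The single equation
   below says both that a k is reduced modulo p^k and that a k.+1 projects to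
   a k. *)
Record padic (p : nat) := Padic {
  padic_seq :> nat -> int;
  padic_compat : forall k, padic_seq k = (padic_seq k.+1 %% (p ^ k)%:Z)%Z
}.

HB.instance Definition _ p := gen_eqMixin (padic p).
HB.instance Definition _ p := gen_choiceMixin (padic p).

Section PadicRing.
Variable p : nat.
Implicit Types (a b c : padic p) (f : nat -> int).

Lemma padic_eqP a b : (forall k, a k = b k) -> a = b.
Proof.
case: a b => [f hf] [g hg] /= fg.
have {}fg : f = g by apply: funext.
by case: _ / fg hg => hg; congr Padic; apply: Prop_irrelevance.
Qed.

Lemma padic_modz a k : (a k %% (p ^ k)%:Z)%Z = a k.
Proof. by rewrite [a k]padic_compat modz_mod. Qed.

Lemma modz_expS (x : int) k :
  ((x %% (p ^ k.+1)%:Z)%Z %% (p ^ k)%:Z)%Z = (x %% (p ^ k)%:Z)%Z.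
Proof.
rewrite [in RHS](divz_eq x (p ^ k.+1)%:Z).
by rewrite [X in _ = ((_ * Posz X + _) %% _)%Z]expnS PoszM mulrA modzMDl.
Qed.

Lemma divz_modM (x e d : int) : d != 0 ->
  (((x %% (e * d))%Z %/ d)%Z = (x %/ d)%Z %[mod e])%Z.
Proof.
by move=> d0; rewrite {2}(divz_eq x (e * d)) mulrA divzMDl // modzMDl.
Qed.

Lemma padic_projE a i j : (a (j + i)%N %% (p ^ i)%:Z)%Z = a i.
Proof.
elim: j => [|j IHj]; first exact: padic_modz.
rewrite -[RHS]IHj [a (j + i)%N]padic_compat addSn.
rewrite {1}(divz_eq (a (j + i).+1) (p ^ (j + i))%:Z) {2}expnD PoszM mulrA.
by rewrite modzMDl.
Qed.

Lemma padic_of_subproof f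
    (hf : forall k, (f k = f k.+1 %[mod (p ^ k)%:Z])%Z) k :
  (f k %% (p ^ k)%:Z)%Z = ((f k.+1 %% (p ^ k.+1)%:Z)%Z %% (p ^ k)%:Z)%Z.
Proof. by rewrite modz_expS hf. Qed.

Definition padic_of f (hf : forall k, (f k = f k.+1 %[mod (p ^ k)%:Z])%Z) :
  padic p := Padic (padic_of_subproof hf).

Lemma padic_eqmod a k : (a k = a k.+1 %[mod (p ^ k)%:Z])%Z.
Proof. by rewrite padic_modz -padic_compat. Qed.

Lemma padic_const_subproof (x : int) k : (x = x %[mod (p ^ k)%:Z])%Z.
Proof. by []. Qed.

Lemma padic_add_subproof a b k :
  (a k + b k = a k.+1 + b k.+1 %[mod (p ^ k)%:Z])%Z.
Proof. by rewrite -modzDm !padic_eqmod modzDm. Qed.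

Lemma padic_opp_subproof a k : (- a k = - a k.+1 %[mod (p ^ k)%:Z])%Z.
Proof. by rewrite -modzNm padic_eqmod modzNm. Qed.

Lemma padic_mul_subproof a b k :
  (a k * b k = a k.+1 * b k.+1 %[mod (p ^ k)%:Z])%Z.
Proof. by rewrite -modzMm !padic_eqmod modzMm. Qed.

Definition padic_zero : padic p := padic_of (padic_const_subproof 0).
Definition padic_one : padic p := padic_of (padic_const_subproof 1).
Definition padic_add a b : padic p := padic_of (padic_add_subproof a b).
Definition padic_opp a : padic p := padic_of (padic_opp_subproof a).
Definition padic_mul a b : padic p := padic_of (padic_mul_subproof a b).

Lemma padic_addA : associative padic_add.
Proof.
by move=> a b c; apply: padic_eqP => k /=; rewrite modzDmr modzDml addrA.
Qed.

Lemma padic_addC : commutative padic_add.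
Proof. by move=> a b; apply: padic_eqP => k /=; rewrite addrC. Qed.

Lemma padic_add0 : left_id padic_zero padic_add.
Proof.
by move=> a; apply: padic_eqP => k /=; rewrite modzDml add0r padic_modz.
Qed.

Lemma padic_addN : left_inverse padic_zero padic_opp padic_add.
Proof. by move=> a; apply: padic_eqP => k /=; rewrite modzDml addNr. Qed.

HB.instance Definition _ := GRing.isZmodule.Build (padic p)
  padic_addA padic_addC padic_add0 padic_addN.

Lemma padic_mulA : associative padic_mul.
Proof.
by move=> a b c; apply: padic_eqP => k /=; rewrite modzMmr modzMml mulrA.
Qed.

Lemma padic_mulC : commutative padic_mul.
Proof. by move=> a b; apply: padic_eqP => k /=; rewrite mulrC. Qed.

Lemma padic_mul1 : left_id padic_one padic_mul.
Proof.
by move=> a; apply: padic_eqP => k /=; rewrite modzMml mul1r padic_modz.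
Qed.

Lemma padic_mulDl : left_distributive padic_mul +%R.
Proof.
by move=> a b c; apply: padic_eqP => k /=; rewrite modzMml modzDm mulrDl.
Qed.

HB.instance Definition _ := GRing.Zmodule_isComPzRing.Build (padic p)
  padic_mulA padic_mulC padic_mul1 padic_mulDl.

Lemma padic_subE a b k : (a - b) k = ((a k - b k) %% (p ^ k)%:Z)%Z.
Proof. by rewrite /= modzDmr. Qed.

Lemma padic_mulE a b k : (a * b) k = ((a k * b k) %% (p ^ k)%:Z)%Z.
Proof. by []. Qed.

Lemma padic_natE n k : (n%:R : padic p) k = (n%:Z %% (p ^ k)%:Z)%Z.
Proof.
elim: n => [|n IHn] //; rewrite -addn1 natrD [LHS]/= IHn /=.
by rewrite modzDm -PoszD.
Qed.

(* Membership in the ideal p^k Z_p, and congruence modulo p^k. *)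
Definition in_ppow (k : nat) a : Prop := exists q : padic p, a = (p ^ k)%:R * q.
Definition congr_ppow (k : nat) a b : Prop := in_ppow k (a - b).

(* The digits a_i of a = \sum_i a_i p^i, and a % p^k = \sum_(i < k) a_i p^i. *)
Definition padic_digit a (i : nat) : nat := `|(a i.+1 %/ (p ^ i)%:Z)%Z|%N.
Definition padic_mod a (k : nat) : nat :=
  (\sum_(i < k) padic_digit a i * p ^ i)%N.

Lemma padic_divp_subproof a k :
  ((a k.+1 %/ p%:Z)%Z = (a k.+2 %/ p%:Z)%Z %[mod (p ^ k)%:Z])%Z.
Proof.
have [p0|p_gt0] := posnP p; first by rewrite (_ : p%:Z = 0) ?p0 ?divz0.
have p_neq0 : p%:Z != 0 by rewrite eqz_nat -lt0n.
by rewrite [a k.+1]padic_compat expnSr PoszM divz_modM.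
Qed.

(* Exact division by p: for a in p Z_p it is the only q with p * q = a, by
   padic_divpK and padic_mulpI below. *)
Definition padic_divp a : padic p := padic_of (padic_divp_subproof a).

Hypothesis p_gt0 : (0 < p)%N.

Lemma padic_ge0 a k : 0 <= a k.
Proof. by rewrite -padic_modz modz_ge0 // eqz_nat -lt0n expn_gt0 p_gt0. Qed.

Lemma padic_lt a k : a k < (p ^ k)%:Z.
Proof. by rewrite -padic_modz ltz_pmod // ltz_nat expn_gt0 p_gt0. Qed.

Lemma padic_0 a : a 0%N = 0.
Proof. by rewrite -padic_modz modz1. Qed.

Lemma ltn_padic_digit a i : (padic_digit a i < p)%N.
Proof.
have pi_gt0 : 0 < (p ^ i)%:Z by rewrite ltz_nat expn_gt0 p_gt0.
rewrite /padic_digit -ltz_nat gez0_abs ?divz_ge0 ?padic_ge0 //.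
by rewrite ltz_divLR // -PoszM -expnS padic_lt.
Qed.

Lemma padic_modE a k : (padic_mod a k)%:Z = a k.
Proof.
have pi_gt0 i : 0 < (p ^ i)%:Z by rewrite ltz_nat expn_gt0 p_gt0.
rewrite /padic_mod; elim: k => [|k IHk]; first by rewrite big_ord0 padic_0.
rewrite big_ord_recr /= PoszD IHk PoszM /padic_digit.
rewrite gez0_abs ?divz_ge0 ?padic_ge0 //.
by rewrite [RHS](divz_eq _ (p ^ k)%:Z) -padic_compat addrC.
Qed.

Lemma ltn_padic_mod1 a : (padic_mod a 1 < p)%N.
Proof. by rewrite -[X in (_ < X)%N]expn1 -ltz_nat padic_modE padic_lt. Qed.

Lemma in_ppowE k a : in_ppow k a <-> a k = 0.
Proof.
have pN0 i : (p ^ i)%:Z != 0 by rewrite eqz_nat -lt0n expn_gt0 p_gt0.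
split=> [[q ->]|ak0].
  by rewrite padic_mulE padic_natE modzz mul0r mod0z.
have dvd_a i : ((p ^ k)%:Z %| a (k + i)%N)%Z.
  elim: i => [|i IHi]; first by rewrite addn0 ak0 dvdz0.
  rewrite addnS (divz_eq (a (k + i).+1) (p ^ (k + i))%:Z) -padic_compat.
  by rewrite rpredD // expnD PoszM dvdz_mull // dvdz_mulr.
have hq i : ((a (k + i)%N %/ (p ^ k)%:Z)%Z =
    (a (k + i.+1)%N %/ (p ^ k)%:Z)%Z %[mod (p ^ i)%:Z])%Z.
  by rewrite [a (k + i)%N]padic_compat addnS addnC expnD PoszM divz_modM.
exists (padic_of hq); apply: padic_eqP => i.
rewrite padic_mulE padic_natE /= modzMm [X in (X %% _)%Z]mulrC divzK //.
by rewrite padic_projE.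
Qed.

Lemma congr_ppowE k a b : congr_ppow k a b <-> a k = b k.
Proof.
rewrite /congr_ppow in_ppowE padic_subE -[X in _ <-> X = _]padic_modz.
rewrite -[X in _ <-> _ = X]padic_modz; split=> [/eqP|/eqP ab].
  by rewrite (sameP eqP dvdz_mod0P) -eqz_mod_dvd => /eqP.
by apply/dvdz_mod0P; rewrite -eqz_mod_dvd.
Qed.

Lemma congr_padic_mod a k : congr_ppow k a (padic_mod a k)%:R.
Proof. by apply/congr_ppowE; rewrite padic_natE padic_modE padic_modz. Qed.

Lemma padic_divpK a : in_ppow 1 a -> p%:R * padic_divp a = a.
Proof.
move=> /in_ppowE a10; apply: padic_eqP => k.
rewrite padic_mulE padic_natE /= modzMm mulrC divzK.
  by rewrite -padic_compat.
elim: k => [|k IHk]; first by rewrite a10 dvdz0.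
rewrite (divz_eq (a k.+2) (p ^ k.+1)%:Z) -padic_compat.
by rewrite rpredD // expnS PoszM dvdz_mull // dvdz_mulr.
Qed.

Lemma padic_mulpI a b : p%:R * a = p%:R * b -> a = b.
Proof.
move=> pab; apply: padic_eqP => k; move: (congr1 (@padic_seq p ^~ k.+1) pab).
rewrite !padic_mulE !padic_natE !modzMml expnS PoszM -!mulz_modr ?ltz_nat //.
by rewrite -!padic_compat => /mulfI-> //; rewrite eqz_nat -lt0n.
Qed.

End PadicRing.

Section FibredFunctions.
Variables (p : nat) (p_gt1 : (1 < p)%N).

Definition rem_p (a : padic p) : 'I_p := Ordinal (ltn_padic_mod1 (ltnW p_gt1) a).

Variable A : set (padic p).

Definition is_digit_table (D : A -> nat -> 'I_p) : Prop :=
  forall n : A, D n 0%N = rem_p (val n).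

Definition block_property (D : A -> nat -> 'I_p) : Prop :=
  forall (k : nat) (m n : A),
    congr_ppow k (val m) (val n) <->
    (forall i, (i < k)%N -> D m i = D n i).

Definition fibred := 'I_p -> A -> padic p.

(* F(n) = (y - y % p) / p with y = F[n % p](n); the division is exact by
   congr_padic_mod. *)
Definition fibred_fun (F : fibred) (n : A) : padic p :=
  let y := F (rem_p (val n)) n in padic_divp (y - (padic_mod y 1)%:R).

Definition closed_fibred (F : fibred) : Prop := forall n : A, fibred_fun F n \in A.

Definition closed_fun (F : fibred) (clF : closed_fibred F) (n : A) : A :=
  exist _ (fibred_fun F n) (clF n).

Definition fibred_table (F : fibred) (clF : closed_fibred F) (n : A) (k : nat) : 'I_p :=
  rem_p (val (iter k (closed_fun clF) n)).

Lemma fibred_table_is_table (F : fibred) (clF : closed_fibred F) :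
  is_digit_table (fibred_table clF).
Proof. by []. Qed.

Definition canonical_form (F : fibred) : Prop :=
  forall (r : 'I_p) (n : A),
    (congr_ppow 1 (val n) (val r)%:R -> in_ppow 1 (F r n)) /\
    (~ congr_ppow 1 (val n) (val r)%:R -> F r n = 0).

End FibredFunctions.

Definition padic_system (p : nat) (p_gt1 : (1 < p)%N)
    (F : fibred [set: padic p]) : Prop :=
  exists clF : closed_fibred p_gt1 F, block_property (fibred_table clF).

(* Main.v *)
(* The block property makes n |-> D[n] a bijection from Z_p onto the digit
   sequences: on prefixes of length k it is an injection between sets with p^k
   elements, hence onto, and the residues obtained for the prefixes of a given
   sequence are compatible.  A fibred function F has table D iff
   D[F(n)] is the shift of D[n] for all n, which therefore determines F(n); the
   canonical form then forces F[n % p](n) = p F(n). *)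
Require Import Defs.
From mathcomp Require Import all_boot all_order all_algebra.
From mathcomp Require Import boolp classical_sets.

Import GRing.Theory.

Section BlockTables.
Set Implicit Arguments.
Local Open Scope ring_scope.

Variables (p : nat) (p_gt1 : (1 < p)%N).
Let p_gt0 : (0 < p)%N := ltnW p_gt1.

Definition full (a : padic p) : [set: padic p]%classic :=
  exist _ a (in_setT a).

Lemma full_val (n : [set: padic p]%classic) : full (val n) = n.
Proof. exact: val_inj. Qed.

Lemma rem_pE (a : padic p) (r : 'I_p) :
  rem_p p_gt1 a = r <-> congr_ppow 1 a (val r)%:R.
Proof.
rewrite congr_ppowE // padic_natE expn1 modz_nat modn_small ?ltn_ord //.
rewrite -(padic_modE p_gt0 a 1).
by split=> [<- //|[ar]]; apply: val_inj.
Qed.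

Lemma in_ppow_mulp (q : padic p) : in_ppow 1 (p%:R * q).
Proof. by exists q; rewrite expn1. Qed.

Lemma in_ppow_mod0 (a : padic p) : in_ppow 1 a -> padic_mod a 1 = 0%N.
Proof.
by move/(in_ppowE p_gt0) => a0; apply/eqP; rewrite -eqz_nat padic_modE ?a0.
Qed.

Lemma padic_divp_mulp (q : padic p) : padic_divp (p%:R * q) = q.
Proof.
apply: (padic_mulpI p_gt0); apply: padic_divpK => //.
exact: in_ppow_mulp.
Qed.

(** Canonical values lie in the ideal of p, so the remainder subtracted in [fibred_fun] is 0 and
    only the division by p has to be undone. *)
Lemma canonical_fibred_funE (F : fibred [set: padic p]%classic)
    (n : [set: padic p]%classic) :
  canonical_form F -> F (rem_p p_gt1 (val n)) n = p%:R * fibred_fun p_gt1 F n.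
Proof.
move=> /(_ (rem_p p_gt1 (val n)) n)[/(_ (iffLR (rem_pE _ _) erefl)) Fp _].
by rewrite /fibred_fun in_ppow_mod0 // subr0 padic_divpK.
Qed.

Variable D : [set: padic p]%classic -> nat -> 'I_p.
Hypothesis D_block : block_property D.

Lemma block_table_inj (m n : [set: padic p]%classic) : D m =1 D n -> m = n.
Proof.
move=> Dmn; apply: val_inj; apply: padic_eqP => k.
by apply/(congr_ppowE p_gt0)/D_block => i _; apply: Dmn.
Qed.

Lemma block_table_prefix (s : nat -> 'I_p) (k : nat) :
  exists a : padic p, forall i, (i < k)%N -> D (full a) i = s i.
Proof.
(* The naturals below p^k represent the residue classes, so both sides of [f] have p^k elements. *)
pose f (x : 'I_(p ^ k)) : {ffun 'I_k -> 'I_p} :=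
  [ffun i : 'I_k => D (full (val x)%:R) i].
have f_inj : injective f.
  move=> x y /ffunP fxy; apply: val_inj.
  have : congr_ppow k ((val x)%:R : padic p) (val y)%:R.
    apply/(D_block k (full _) (full _)) => i ik.
    by have := fxy (Ordinal ik); rewrite !ffunE.
  rewrite congr_ppowE // !padic_natE !modz_nat !modn_small ?ltn_ord //.
  by case.
have /codomP[x sx] : [ffun i : 'I_k => s i] \in codom f.
  by apply: inj_card_onto => //; rewrite card_ffun !card_ord.
exists (val x)%:R => i ik.
by have /ffunP/(_ (Ordinal ik)) := sx; rewrite !ffunE.
Qed.

Lemma block_table_surj (s : nat -> 'I_p) :
  exists n : [set: padic p]%classic, D n =1 s.
Proof.
have [a Da] := choice (block_table_prefix s).
(* The tables at [a k] and [a k.+1] agree with [s] on k entries, so these points are congruent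
   modulo p^k. *)
have a_compat k : (a k k = a k.+1 k.+1 %[mod (p ^ k)%:Z])%Z.
  rewrite padic_modz -padic_compat.
  apply/(congr_ppowE p_gt0)/(D_block k (full _) (full _)) => i ik.
  by rewrite !Da // ltnS ltnW.
exists (full (padic_of a_compat)) => i.
(* Entry i is covered only by prefixes of length at least [i.+1]. *)
rewrite -(Da i.+1) //; apply: (iffLR (D_block i.+1 _ _)) (ltnSn i).
by apply/(congr_ppowE p_gt0) => /=; rewrite padic_modz.
Qed.

Hypothesis D_table : is_digit_table p_gt1 D.

(** The orbit of F(n) is the orbit of n without its first term. Conversely, the shift relation moves
    each entry down to position 0, where [D_table] fixes it. *)
Lemma fibred_tableP (F : fibred [set: padic p]%classic)
    (clF : closed_fibred p_gt1 F) :
  fibred_table clF = D <->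
  forall n, D (full (fibred_fun p_gt1 F n)) =1 (fun k => D n k.+1).
Proof.
have clFE n : closed_fun clF n = full (fibred_fun p_gt1 F n) by exact: val_inj.
split=> [<- n k|DF].
  by rewrite /fibred_table iterSr clFE.
apply/funext => n; apply/funext => k.
elim: k n => [|k IHk] n; first by rewrite D_table.
by rewrite -DF -IHk /fibred_table iterSr clFE.
Qed.

End BlockTables.

Theorem theorem3p12 (p : nat) (p_gt1 : (1 < p)%N)
    (D : [set: padic p]%classic -> nat -> 'I_p)
    (D_table : is_digit_table p_gt1 D) (D_block : block_property D) :
  exists F : fibred [set: padic p]%classic,
    unique (fun F => canonical_form F /\
                     exists clF : closed_fibred p_gt1 F, fibred_table clF = D) F
    /\ padic_system p_gt1 F.
Proof.
have [G DG] := choice (fun n => block_table_surj p_gt1 D_block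
                                  (fun k => D n k.+1)).
(* [G n] is the intended F(n). The factor p cancels the division in [fibred_fun]; the canonical form
   imposes the 0. *)
pose F : fibred [set: padic p]%classic := fun r n =>
  if rem_p p_gt1 (val n) == r then (p%:R * val (G n))%R else 0%R.
have FE n : full (fibred_fun p_gt1 F n) = G n.
  rewrite /fibred_fun /F eqxx in_ppow_mod0 //; last exact: in_ppow_mulp.
  by rewrite subr0 padic_divp_mulp // full_val.
have clF : closed_fibred p_gt1 F by move=> n; apply: in_setT.
have tF : fibred_table clF = D.
  by apply/fibred_tableP => // n; rewrite FE; apply: DG.
exists F; split; last by exists clF; rewrite tF.
split.
  split; last by exists clF.
  move=> r n; rewrite -(rem_pE p_gt1) /F; split=> [->|/eqP/negPf-> //].
  by rewrite eqxx; apply: in_ppow_mulp.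
move=> F' [canF' [clF' /fibred_tableP-/(_ D_table) DF']].
apply/funext => r; apply/funext => n; rewrite /F.
have [<-|/eqP rn] := eqVneq; last first.
  by rewrite (proj2 (canF' r n)) // -(rem_pE p_gt1).
(* Both sides are p times a point whose row in [D] is the shifted row of n, and rows determine
   points. *)
rewrite canonical_fibred_funE // -[fibred_fun _ _ _]/(val (full _)).
congr (_ * val _)%R; apply: (block_table_inj p_gt1 D_block) => // k.
by rewrite DF' DG.
Qed.
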